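(* Let $T$ be a tree rooted at $o$, let $X$ be either $\mathcal{L}_{\mathbf{w}}$ or $\mathcal{L}_{\mathbf{w},0}$, and let $\psi:T\to\mathbb{C}$ be such that $M_\psi$ is a bounded multiplication operator on $X$. Then the approximate point spectrum of $M_\psi$ on $X$ is $\sigma_{ap}(M_\psi)=\overline{\psi(T)}$, the closure of the range of $\psi$ in $\mathbb{C}$.
   Context: A tree $T$ is a locally finite, connected, simply-connected graph, identified with its set of vertices; $T$ is assumed to have no terminal vertices (vertices with exactly one neighbor), so it is infinite, and it is rooted at a vertex $o$. $|v|$ is the number of edges in the unique path from $o$ to $v$; $T^*=T\setminus\{o\}$; for $v\in T^*$, $v^-$ is the neighbor of $v$ closest to $o$. For $f:T\to\mathbb{C}$ and $v\in T^*$, $Df(v)=|f(v)-f(v^-)|$. The weighted Lipschitz space $\mathcal{L}_{\mathbf{w}}$ is the set of $f:T\to\mathbb{C}$ with $\sup_{v\in T^*}|v|Df(v)<\infty$, normed by $\|f\|_{\mathbf{w}}=|f(o)|+\sup_{v\in T^*}|v|Df(v)$ (a Banach space). The little weighted Lipschitz space $\mathcal{L}_{\mathbf{w},0}$ is the closed subspace of those $f\in\mathcal{L}_{\mathbf{w}}$ with $\lim_{|v|\to\infty}|v|Df(v)=0$. $M_\psi f=\psi f$ (pointwise product); ''$M_\psi$ is bounded on $X$'' means $M_\psi$ maps $X$ into $X$ and is a bounded linear operator there. For a bounded operator $S$ on a Banach space $X$ with identity $I$, $\sigma_{ap}(S)$ is the set of $\lambda\in\mathbb{C}$ for which there is a sequence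 $\{x_n\}\subseteq X$ with $\|x_n\|=1$ for all $n$ and $\|(S-\lambda I)x_n\|\to 0$. *)

(* Defs.v *)
From mathcomp Require Import all_boot all_order all_algebra.
From mathcomp Require Import complex.
From mathcomp Require Import all_classical all_reals all_analysis.

Set Implicit Arguments.
Unset Strict Implicit.
Unset Printing Implicit Defensive.

Import Order.TTheory GRing.Theory Num.Theory.
Import numFieldNormedType.Exports.

Local Open Scope classical_set_scope.
Local Open Scope ring_scope.

(* The modulus |z| of a complex number, as an element of R (the library norm
   `|z| on R[i] takes its values in R[i]). *)
Notation cmod := ComplexField.Normc.normc.

Definition terminal (V : choiceType) (e : rel V) (v : V) : Prop :=
  exists! u, e v u.

(* Simple connectedness of a graph is the absence of simple closed paths of
   length at least 3. The field [tree_infinite] only excludes the graph with a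
   single vertex, which has no terminal vertex in the sense above. *)
Record is_tree (V : choiceType) (e : rel V) : Prop := IsTree {
  tree_irreflexive : irreflexive e ;
  tree_symmetric : symmetric e ;
  tree_locally_finite : forall v, finite_set [set u | e v u] ;
  tree_connected : forall u v, exists2 p, path e u p & last u p = v ;
  tree_acyclic : forall c : seq V, (2 < size c)%N -> ~ ucycle e c ;
  tree_no_terminal : forall v, ~ terminal e v ;
  tree_infinite : infinite_set [set: V]
}.

Section RootedTree.
Context {V : choiceType}.
Variables (e : rel V) (o : V).

(* A path is the root [o] followed by the sequence [p]; its number of edges is
   [size p]. In a tree exactly one [p] satisfies [simple_path_to v]. *)
Definition simple_path_to (v : V) : set (seq V) :=
  [set p | [/\ path e o p, uniq (o :: p) & last o p = v]].

Definition level (v : V) : nat := size (xget [::] (simple_path_to v)).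

Definition parent (v : V) : V :=
  xget o [set u | e v u /\ forall w, e v w -> (level u <= level w)%N].

(* The filter of |v| -> oo. *)
Definition level_infty : set_system V :=
  filter_from [set: nat] (fun N => [set v | (N <= level v)%N]).

Section Lipschitz.
Context {R : realType}.
Implicit Types f : V -> R[i].

Definition derivT f (v : V) : R := cmod (f v - f (parent v)).

Definition wderiv f (v : V) : R := (level v)%:R * derivT f v.

Definition wderiv_range f : set R := wderiv f @` [set v | v != o].

Definition Lw : set (V -> R[i]) := [set f | has_ubound (wderiv_range f)].

Definition normw f : R := cmod (f o) + sup (wderiv_range f).

Definition Lw0 : set (V -> R[i]) :=
  [set f | Lw f /\ wderiv f @ level_infty --> (0 : R)].

End Lipschitz.
End RootedTree.

Definition multop (V : Type) (R : realType) (psi : V -> R[i])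
  (f : V -> R[i]) : V -> R[i] := fun v => psi v * f v.

(* A normed space is given as a subset [X] of a complex vector space [E],
   with a function [nrm] whose restriction to [X] is the norm. *)
Section Operators.
Context {R : realType} {E : lmodType R[i]}.
Variables (X : set E) (nrm : E -> R).

Record bounded_operator (S : E -> E) : Prop := BoundedOperator {
  bop_stable : forall x, X x -> X (S x) ;
  bop_linear : forall (a : R[i]) x y, X x -> X y ->
    S (a *: x + y) = a *: S x + S y ;
  bop_bounded : exists C : R, forall x, X x -> nrm (S x) <= C * nrm x
}.

Definition approx_point_spectrum (S : E -> E) : set R[i] :=
  [set lambda | exists x : nat -> E,
    [/\ forall n, X (x n), forall n, nrm (x n) = 1 &
        (fun n => nrm (S (x n) - lambda *: x n)) @ \oo --> (0 : R)]].

End Operators.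

(* Main.v *)
(** Indicators of vertices are eigenfunctions, with eigenvalue [psi v]; hence
    the closure of the range of [psi] consists of approximate eigenvalues, and
    [psi] is bounded by the operator norm [C].  Applying [M_psi] to the harmonic
    sums [H |v|], truncated so that they lie in the little space, yields
    [|v| H(|v|) D psi(v) <= 2 C].  If [|psi - l| >= c > 0] and
    [y = (psi - l) x], then [|y(v)| <= ||y|| (1 + H |v|)] by telescoping, and
    [y(v) - y(v^-) = (psi(v^-) - l) (x(v) - x(v^-)) + (psi(v) - psi(v^-)) x(v)]
    bounds [||x||] by a constant times [||y||], so [l] is not an approximate
    eigenvalue. *)

Require Import Defs.
From mathcomp Require Import all_boot all_order all_algebra.
From mathcomp Require Import complex.
From mathcomp Require Import all_classical all_reals all_analysis.
From mathcomp Require Import ring zify.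

Set Implicit Arguments.
Unset Strict Implicit.
Unset Printing Implicit Defensive.

Import Order.TTheory GRing.Theory Num.Theory.
Import numFieldNormedType.Exports.
Import ComplexField.Normc.

Local Open Scope classical_set_scope.
Local Open Scope ring_scope.

(** * Simple paths, levels and parents in a tree *)

Lemma simple_path_unique (V : choiceType) (e : rel V) (x y : V)
    (p q : seq V) (hT : is_tree e) :
  simple_path_to e x y p -> simple_path_to e x y q -> p = q.
Proof.
elim: p x q => [|a p IHp] x [|b q] // [/= ep up lp] [/= eq uq lq].
- by case/andP: uq; rewrite lp -lq mem_last.
- by case/andP: up; rewrite lq -lp mem_last.
have [ab|ab] := eqVneq a b.
  subst b; congr (_ :: _); apply: (IHp a); split=> //.
  + by case/andP: ep.
  + by case/andP: up.
  + by case/andP: eq.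
  + by case/andP: uq.
exfalso.
(* Closing up [p] at its first meeting point [z] with [q] gives a cycle. *)
have hasz : has (mem (b :: q)) (a :: p).
  apply/hasP; exists y; first by rewrite -lp mem_last.
  by have := mem_last b q; rewrite lq.
have [z [p1 [p2 [zq p1q defp]]]] : exists z p1 p2, [/\ z \in b :: q,
    ~~ has (mem (b :: q)) p1 & a :: p = p1 ++ z :: p2].
  case: (split_find hasz) => z s1 s2 hz hs; exists z, s1, s2; split=> //.
  by rewrite cat_rcons.
have [q1 [q2 defq]] : exists q1 q2, b :: q = q1 ++ z :: q2.
  by case/splitPr: zq => q1 q2; exists q1, q2.
have {}ep : path e x (rcons p1 z).
  have : path e x (p1 ++ z :: p2) by rewrite -defp.
  by rewrite -cat_rcons cat_path => /andP[].
have {}up : uniq (x :: rcons p1 z).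
  have : uniq (x :: p1 ++ z :: p2) by rewrite -defp.
  by rewrite -cat_rcons -cat_cons cat_uniq => /andP[].
have {}eq : path e x (rcons q1 z).
  have : path e x (q1 ++ z :: q2) by rewrite -defq.
  by rewrite -cat_rcons cat_path => /andP[].
have {}uq : uniq (x :: rcons q1 z).
  have : uniq (x :: q1 ++ z :: q2) by rewrite -defq.
  by rewrite -cat_rcons -cat_cons cat_uniq => /andP[].
apply: (tree_acyclic hT (c := x :: rcons p1 z ++ rev q1)).
  (* The closed walk has at least three vertices unless [p1] and [q1] are both empty, and then
     [a = z = b]. *)
  case: p1 q1 {p1q ep up eq uq} defp defq => [|? ?] [|? ?] //= [az _] [bz _].
  - by rewrite az bz eqxx in ab.
  - by rewrite size_rev.
  - by rewrite size_cat size_rcons.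
  - by rewrite size_cat size_rcons.
apply/andP; split.
  rewrite /= rcons_cat cat_path ep last_rcons -rev_cons /=.
  move: eq; rewrite -rev_path last_rcons belast_rcons.
  by rewrite (eq_path (e' := e)) // => u v; rewrite (tree_symmetric hT).
rewrite -cat_cons cat_uniq up rev_uniq /=.
move: uq; rewrite /= rcons_uniq mem_rcons inE negb_or.
case/andP=> /andP[xz xq1] /andP[zq1 ->]; rewrite andbT.
apply/hasPn => u; rewrite mem_rev => uq1.
rewrite inE mem_rcons inE !negb_or; apply/and3P; split.
- by apply: contraNneq xq1 => <-.
- by apply: contraNneq zq1 => <-.
- apply: contra p1q => up1; apply/hasP; exists u => //=.
  by rewrite defq mem_cat uq1.
Qed.

Lemma level_root (V : choiceType) (e : rel V) (o : V) : level e o o = 0%N.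
Proof.
rewrite /level; case: xgetP => [p _ [_ up lp]|//].
case: p up lp => [//|a p] /= /andP[+ _] lp.
by rewrite -{1}lp mem_last.
Qed.

Lemma level_simple_path (V : choiceType) (e : rel V) (o v : V) (p : seq V)
    (hT : is_tree e) : simple_path_to e o v p -> level e o v = size p.
Proof.
move=> hp; rewrite /level; congr size; apply: xget_unique => // q hq.
exact: simple_path_unique hT hq hp.
Qed.

Lemma simple_path_exists (V : choiceType) (e : rel V) (o v : V)
    (hT : is_tree e) : exists p, simple_path_to e o v p.
Proof.
have [p ep lp] := tree_connected hT o v.
by case: (shortenP ep) lp => p' ep' up' _ lp'; exists p'.
Qed.

(** Dropping the last vertex of the simple path to [v] leaves a path to a neighbor of level one
    less, and no neighbor of [v] has a smaller level. *)
Lemma level_parent (V : choiceType) (e : rel V) (o v : V) (hT : is_tree e) :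
  v != o -> level e o v = (level e o (parent e o v)).+1.
Proof.
move=> vo; have [p hp] := simple_path_exists o v hT.
have lv := level_simple_path hT hp.
case/lastP: p hp lv => [[_ _ /= ov]|q v' [eq uq]].
  by rewrite ov eqxx in vo.
rewrite last_rcons => vv'; subst v'; rewrite size_rcons => lv.
move: eq uq; rewrite rcons_path -rcons_cons rcons_uniq.
move=> /andP[eq elv] /andP[vq uq].
have lu : level e o (last o q) = size q by apply: level_simple_path.
have umin w : e v w -> (level e o (last o q) <= level e o w)%N.
  move=> evw; have [r hr] := simple_path_exists o w hT.
  rewrite lu (level_simple_path hT hr); case: hr => er ur lr.
  (* If the path [r] to [w] avoids [v], it extends to the simple path to [v], so [w] has the level
     of [last o q]. If it meets [v], its part up to [v] is the simple path to [v], so [w] is even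
     further from the root. *)
  have [vr|vr] := boolP (v \in o :: r); last first.
    have /(level_simple_path hT) : simple_path_to e o v (rcons r v).
      split; last by rewrite last_rcons.
      - by rewrite rcons_path er lr (tree_symmetric hT).
      - by rewrite -rcons_cons rcons_uniq vr.
    by rewrite lv size_rcons => -[->].
  have {}vr : v \in r by move: vr; rewrite inE (negPf vo).
  case/splitPr: vr er ur {lr} => r1 r2; rewrite -cat_rcons cat_path.
  move=> /andP[er1 _]; rewrite -cat_cons cat_uniq => /andP[ur1 _].
  have /(level_simple_path hT) : simple_path_to e o v (rcons r1 v).
    by split=> //; rewrite last_rcons.
  by rewrite lv size_rcons size_cat size_rcons => -[->]; lia.
(* Whichever minimizer [xget] picks has the same level as [last o q], by minimality both ways. The
   default value is excluded since [last o q] is a minimizer. *)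
rewrite /parent; case: xgetP => [u _ [evu hu]|/(_ (last o q)) []].
  rewrite lv; congr _.+1; apply/eqP; rewrite eqn_leq -lu umin //= hu //.
  by rewrite (tree_symmetric hT).
by split=> //; rewrite (tree_symmetric hT).
Qed.

(** * The complex modulus and closures in the complex plane *)

Lemma cmodD (R : realType) (x y : R[i]) : cmod (x + y) <= cmod x + cmod y.
Proof. exact: le_normcD. Qed.

Lemma cmodN (R : realType) (x : R[i]) : cmod (- x) = cmod x.
Proof. exact: normcN. Qed.

Lemma cmodM (R : realType) (x y : R[i]) : cmod (x * y) = cmod x * cmod y.
Proof. exact: normcM. Qed.

Lemma cmodB (R : realType) (x y : R[i]) : cmod (x - y) <= cmod x + cmod y.
Proof. by rewrite -(cmodN y) cmodD. Qed.

Lemma cmod_ge0 (R : realType) (x : R[i]) : 0 <= cmod x.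
Proof. by case: x => a b; rewrite sqrtr_ge0. Qed.

Lemma cmod_real (R : realType) (a : R) : cmod a%:C%C = `|a|.
Proof. by rewrite /= expr0n addr0 sqrtr_sqr. Qed.

Lemma normCE (R : realType) (x : R[i]) : `|x| = (cmod x)%:C%C.
Proof. by []. Qed.

(** Balls in [R[i]] have radii in [R[i]]; a positive radius has zero imaginary part, so real radii
    suffice. *)
Lemma closure_cmod (R : realType) (A : set R[i]) (l : R[i]) :
  closure (A : set (R[i] : numFieldType)) l <-> forall eps : R, 0 < eps ->
  exists2 z, A z & cmod (z - l) < eps.
Proof.
split=> [cl eps e0|H B].
  have e0' : (0 : R[i]) < eps%:C%C by rewrite ltcR.
  have [z [Az]] := cl _ (nbhsx_ballx (l : (R[i] : numFieldType)) _ e0').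
  rewrite /ball /= -opprB normrN => h.
  by exists z => //; rewrite -ltcR.
move=> /nbhs_ballP[d /= d0 dB].
have [dr dim] : 0 < complex.Re d /\ complex.Im d = 0.
  by case: d d0 {dB} => a b; rewrite ltcE /= => /andP[/eqP -> ->].
have [z Az hz] := H _ dr; exists z; split=> //; apply: dB.
rewrite /ball /= -opprB normrN normCE.
by case: d d0 dr dim hz => a b /= _ _ -> hz; rewrite ltcR.
Qed.

(** * The weighted derivative and the norm it defines *)

Section Lipschitz.
Context {R : realType} {V : choiceType} {e : rel V} {o : V}.
Implicit Types (f : V -> R[i]) (v : V) (B : R).

Lemma wderiv_ge0 f v : 0 <= wderiv e o f v.
Proof. by rewrite mulr_ge0 // cmod_ge0. Qed.

Lemma wderiv_root f : wderiv e o f o = 0.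
Proof. by rewrite /wderiv level_root mul0r. Qed.

Lemma Lw_le f B : (forall v, wderiv e o f v <= B) -> Lw e o f.
Proof. by move=> h; exists B => _ [v _ <-]. Qed.

Lemma le_sup_wderiv f v : Lw e o f ->
  0 <= sup (wderiv_range e o f) /\ wderiv e o f v <= sup (wderiv_range e o f).
Proof.
move=> hf; have le w : w != o -> wderiv e o f w <= sup (wderiv_range e o f).
  by move=> wo; apply: ub_le_sup => //; exists w.
have [->|vo] := eqVneq v o; last first.
  by split; [exact: le_trans (wderiv_ge0 f v) (le _ vo)|exact: le].
suff h : 0 <= sup (wderiv_range e o f) by rewrite wderiv_root.
(* The root lies outside the range of the supremum, which may then be empty; [sup] of the empty set
   is 0. *)
have [->|/set0P[_ [w wo _]]] := eqVneq (wderiv_range e o f) set0.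
  by rewrite sup0.
exact: le_trans (wderiv_ge0 f w) (le _ wo).
Qed.

Lemma wderiv_le_normw f v : Lw e o f -> wderiv e o f v <= normw e o f.
Proof.
by move=> /(@le_sup_wderiv _ v)[_ h]; rewrite /normw ler_wpDl // cmod_ge0.
Qed.

Lemma root_le_normw f : Lw e o f -> cmod (f o) <= normw e o f.
Proof. by move=> /(@le_sup_wderiv _ o)[h _]; rewrite /normw ler_wpDr. Qed.

Lemma normw_ge0 f : Lw e o f -> 0 <= normw e o f.
Proof. by move=> /root_le_normw; apply: le_trans; exact: cmod_ge0. Qed.

Lemma normw_le f B : (forall v, wderiv e o f v <= B) ->
  normw e o f <= cmod (f o) + B.
Proof.
move=> h; rewrite lerD2l.
have [->|/set0P ne] := eqVneq (wderiv_range e o f) set0.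
  by rewrite sup0 -(wderiv_root f).
by apply: ge_sup => // _ [v _ <-].
Qed.

Lemma wderivZ (a : R[i]) f v :
  wderiv e o (a *: f) v = cmod a * wderiv e o f v.
Proof.
by rewrite /wderiv /derivT -[_ - _]/(a * f v - a * _) -mulrBr cmodM mulrCA.
Qed.

Lemma LwZ (a : R[i]) f : Lw e o f -> Lw e o (a *: f).
Proof.
move=> hf; apply: (@Lw_le _ (cmod a * normw e o f)) => v.
by rewrite wderivZ ler_wpM2l ?cmod_ge0 // wderiv_le_normw.
Qed.

(** The inequality [le] for [a] gives one direction; applied to [a^-1] and [a *: f] it gives the
    other. *)
Lemma normwZ (a : R[i]) f : Lw e o f ->
  normw e o (a *: f) = cmod a * normw e o f.
Proof.
have le (b : R[i]) (g : V -> R[i]) : Lw e o g ->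
    normw e o (b *: g) <= cmod b * normw e o g.
  move=> hg; rewrite mulrDr -cmodM.
  apply: (@normw_le (b *: g)) => v.
  rewrite wderivZ ler_wpM2l ?cmod_ge0 //.
  by have [] := le_sup_wderiv v hg.
move=> hf; apply/eqP; rewrite eq_le le //=.
have [->|a0] := eqVneq a 0.
  rewrite [cmod 0]normc0 mul0r; apply: normw_ge0.
  exact: LwZ.
have ca : cmod a * cmod a^-1 = 1.
  by rewrite -cmodM divff // [LHS]normc1.
rewrite -[X in _ * normw _ _ X](scale1r f) -(mulVf a0) -scalerA.
apply: le_trans (ler_wpM2l (cmod_ge0 a) (le a^-1 _ (LwZ a hf))) _.
by rewrite mulrA ca mul1r.
Qed.

Lemma Lw0_eventually_const f (N : nat) B :
  (forall v, (N < level e o v)%N -> f v = f (parent e o v)) ->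
  (forall v, wderiv e o f v <= B) -> Lw0 e o f.
Proof.
move=> hN hB; split; first exact: Lw_le hB.
move=> A A0; exists N.+1 => // v /= /hN fv.
rewrite /wderiv /derivT fv subrr [cmod 0]normc0 mulr0.
exact: nbhs_singleton A0.
Qed.

(** * Indicators of vertices as eigenfunctions in the little space *)

Definition indic_vertex v : V -> R[i] := fun u => (u == v)%:R.

Hypothesis hT : is_tree e.

Lemma indic_vertex_parent v u : ((level e o v).+1 < level e o u)%N ->
  indic_vertex v u = indic_vertex v (parent e o u).
Proof.
have [->|uo] := eqVneq u o; first by rewrite level_root.
rewrite (level_parent hT uo) ltnS => lu; rewrite /indic_vertex.
have -> : (u == v) = false.
  apply: contraTF lu => /eqP <-.
  by rewrite (level_parent hT uo) -leqNgt leqnSn.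
have -> // : (parent e o u == v) = false.
by apply: contraTF lu => /eqP <-; rewrite ltnn.
Qed.

(** The indicator jumps, by 1, only between [u] and its parent when one of them is [v], which forces
    [u] to have level at most that of [v] plus one. *)
Lemma wderiv_indic_vertex_le v u :
  wderiv e o (indic_vertex v) u <= (level e o v).+1%:R.
Proof.
have [lu|lu] := ltnP (level e o v).+1 (level e o u).
  by rewrite /wderiv /derivT indic_vertex_parent // subrr normc0 mulr0.
rewrite -[leRHS]mulr1; apply: ler_pM => //; first exact: cmod_ge0.
  by rewrite ler_nat.
rewrite /derivT /indic_vertex.
by do 2 case: (_ == v); rewrite ?subrr ?subr0 ?sub0r ?cmodN ?normc1 ?normc0.
Qed.

Lemma Lw0_indic_vertex (a : R[i]) v : Lw0 e o (a *: indic_vertex v).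
Proof.
apply: (@Lw0_eventually_const _ (level e o v).+1
  (cmod a * (level e o v).+1%:R)) => u.
  by move=> /indic_vertex_parent h; rewrite -[LHS]/(a * _) h.
by rewrite wderivZ ler_wpM2l ?cmod_ge0 // wderiv_indic_vertex_le.
Qed.

Lemma Lw_indic_vertex v : Lw e o (indic_vertex v).
Proof. exact: Lw_le (wderiv_indic_vertex_le v). Qed.

Lemma normw_indic_vertex_gt0 v : 0 < normw e o (indic_vertex v).
Proof.
have hL := Lw_indic_vertex v.
have [vo|vo] := eqVneq v o.
  apply: lt_le_trans (root_le_normw hL).
  by rewrite /indic_vertex vo eqxx normc1.
apply: lt_le_trans (wderiv_le_normw v hL).
have lv := level_parent hT vo.
rewrite /wderiv /derivT /indic_vertex eqxx.
have -> : (parent e o v == v) = false.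
  apply/eqP => pv; move: lv; rewrite pv => /eqP.
  by rewrite eqn_leq ltnn andbF.
by rewrite subr0 normc1 mulr1 ltr0n lv.
Qed.

Lemma multop_indic_vertex (psi : V -> R[i]) v :
  multop psi (indic_vertex v) = psi v *: indic_vertex v.
Proof.
apply/funext => u; rewrite -[RHS]/(psi v * _) /multop /indic_vertex.
by have [->//|_] := eqVneq u v; rewrite !mulr0.
Qed.

Lemma LwB f g : Lw e o f -> Lw e o g -> Lw e o (f - g).
Proof.
move=> hf hg; apply: (@Lw_le _ (normw e o f + normw e o g)) => v.
apply: le_trans (lerD (wderiv_le_normw v hf) (wderiv_le_normw v hg)).
rewrite /wderiv -mulrDr ler_wpM2l // /derivT.
rewrite -[X in cmod X]/((f v - g v) - (f _ - g _)).
by rewrite opprD addrACA -opprD cmodB.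
Qed.

(** * Growth of Lipschitz functions and the harmonic sums [H n = 1 + 1/2 + ... + 1/n] *)

Local Notation H := (series (@harmonic R)).

Lemma harmonic_sum_ge0 n : 0 <= H n.
Proof. by apply: sumr_ge0 => k _; exact: harmonic_ge0. Qed.

Lemma harmonic_sum_ge1 n : 1 <= H n.+1.
Proof.
elim: n => [|n IH]; first by rewrite /series /= big_nat1 /harmonic invr1.
by rewrite seriesSr (le_trans IH) // lerDl harmonic_ge0.
Qed.

(** Induction towards the root: the edge below a vertex of level [k] costs at most
    [normw e o f / k], and the summand 1 pays for the value at the root. *)
Lemma cmod_le_normw f v : Lw e o f ->
  cmod (f v) <= normw e o f * (1 + H (level e o v)).
Proof.
move=> hf; have [n] := ubnP (level e o v).
elim: n v => // n IH v; rewrite ltnS => lv.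
have [->|vo] := eqVneq v o.
  apply: le_trans (root_le_normw hf) _.
  by rewrite ler_peMr ?normw_ge0 // lerDl harmonic_sum_ge0.
have lp := level_parent hT vo.
have {IH} IHp : cmod (f (parent e o v)) <=
    normw e o f * (1 + H (level e o (parent e o v))).
  by apply: IH; rewrite -lp.
have : derivT e o f v <= normw e o f * harmonic (level e o (parent e o v)).
  rewrite /harmonic ler_pdivlMr ?ltr0n // mulrC -lp.
  exact: wderiv_le_normw.
rewrite lp seriesSr => hD; rewrite addrA mulrDr.
apply: le_trans (lerD IHp hD).
by rewrite /derivT -{1}(subrK (f (parent e o v)) (f v)) addrC cmodD.
Qed.

(** This attains the logarithmic growth allowed by [cmod_le_normw] up to level [N], with norm at
    most 1 whatever [N] is. Being constant along edges beyond level [N] puts it in the little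
    space. *)
Definition harmonic_test (N : nat) : V -> R[i] :=
  fun v => (H (minn (level e o v) N))%:C%C.

Lemma wderiv_harmonic_test_le N v : wderiv e o (harmonic_test N) v <= 1.
Proof.
have [->|vo] := eqVneq v o; first by rewrite wderiv_root.
rewrite /wderiv /derivT /harmonic_test (level_parent hT vo) -rmorphB cmod_real.
set n := level e o (parent e o v).
have [nN|Nn] := ltnP n N.
  rewrite (minn_idPl nN) seriesSB.
  by rewrite ger0_norm ?harmonic_ge0 // /harmonic mulfV // pnatr_eq0.
by rewrite (minn_idPr (leqW Nn)) subrr normr0 mulr0.
Qed.

Lemma Lw0_harmonic_test N : Lw0 e o (harmonic_test N).
Proof.
apply: (@Lw0_eventually_const _ N 1); last exact: wderiv_harmonic_test_le.
move=> v; have [->|vo] := eqVneq v o; first by rewrite level_root.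
rewrite /harmonic_test (level_parent hT vo) ltnS => Nn.
by rewrite (minn_idPr Nn) (minn_idPr (leqW Nn)).
Qed.

Lemma normw_harmonic_test_le N : normw e o (harmonic_test N) <= 1.
Proof.
apply: le_trans (normw_le (@wderiv_harmonic_test_le N)) _.
by rewrite /harmonic_test level_root min0n cmod_real /series /= big_geq //
  normr0 add0r.
Qed.

(** * Estimates on the symbol of a bounded multiplication operator *)

Section Multiplier.
Variables (X : set (V -> R[i])) (psi : V -> R[i]).
(** All test functions lie in the little space and all norm estimates hold in the large one, so this
    sandwich treats both spaces at once. *)
Hypotheses (Lw0X : Lw0 e o `<=` X) (XLw : X `<=` Lw e o).
Hypothesis hpsi : bounded_operator X (normw e o) (multop psi).

Lemma multiplier_bounds : exists C : R, [/\ 0 <= C,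
  forall v, cmod (psi v) <= C &
  forall v, (level e o v)%:R * H (level e o v) * derivT e o psi v <= C + C].
Proof.
have [C hC] := bop_bounded hpsi.
have bd v : cmod (psi v) <= C.
  rewrite -(ler_pM2r (normw_indic_vertex_gt0 v)) -normwZ; last first.
    exact: Lw_indic_vertex.
  rewrite -multop_indic_vertex; apply/hC/Lw0X.
  by rewrite -[indic_vertex v]scale1r; exact: Lw0_indic_vertex.
have C0 : 0 <= C := le_trans (cmod_ge0 _) (bd o).
exists C; split=> // v.
have [->|vo] := eqVneq v o; first by rewrite level_root !mul0r addr_ge0.
have lp := level_parent hT vo; set p := parent e o v in lp.
set n := level e o p in lp.
(* Truncating at the level of [v] leaves the values at [v] and [p] equal to the full harmonic
   sums. *)
have XN : X (harmonic_test n.+1) by apply/Lw0X/Lw0_harmonic_test.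
have le1 : wderiv e o (multop psi (harmonic_test n.+1)) v <= C.
  apply: le_trans (wderiv_le_normw v (XLw (bop_stable hpsi XN))) _.
  apply: le_trans (hC _ XN) _.
  by rewrite ler_piMr // normw_harmonic_test_le.
have le2 : n.+1%:R * (cmod (psi p) * harmonic n) <= C.
  by rewrite /harmonic mulrCA mulfV ?mulr1 ?bd // pnatr_eq0.
(* Product rule: [(psi v - psi p) * H n.+1] is the increment of the product minus
   [psi p * (H n.+1 - H n)]; each term, weighted by the level, is at most [C]. *)
apply: le_trans (lerD le1 le2).
rewrite /wderiv lp -mulrA -mulrDr ler_wpM2l // /derivT /multop.
rewrite /harmonic_test -/p lp -/n minnn (minn_idPl (leqnSn n)).
have -> : harmonic n = cmod (H n.+1 - H n)%:C%C :> R.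
  by rewrite seriesSB cmod_real ger0_norm ?harmonic_ge0.
rewrite -{1}[H n.+1]ger0_norm ?harmonic_sum_ge0 // -cmod_real -!cmodM.
apply: le_trans (cmodB _ _); rewrite rmorphB.
by rewrite le_eqVlt; apply/predU1P; left; congr cmod; ring.
Qed.

Lemma multiplier_bounded_below (l : R[i]) (c : R) : 0 < c ->
  (forall v, c <= cmod (psi v - l)) ->
  exists2 K : R, 0 < K &
    forall x, X x -> normw e o x <= K * normw e o (multop psi x - l *: x).
Proof.
move=> c0 hc; have [C [C0 _ hC]] := multiplier_bounds.
(* The summand [c^-1] controls the value at the root. In the other, 1 comes from the derivative of
   [y], [C + C] from that of [psi], and [2 / c] from the bound [h2] on [x v]. *)
exists (c^-1 + (1 + (C + C) * 2 / c) / c).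
  rewrite ltr_pwDl ?invr_gt0 // divr_ge0 ?(ltW c0) // addr_ge0 //.
  by rewrite divr_ge0 ?(ltW c0) // mulr_ge0 // addr_ge0.
move=> x Xx; set y := multop psi x - l *: x.
have yE v : y v = (psi v - l) * x v.
  by rewrite -[y v]/(psi v * x v - l * x v) mulrBl.
have Ly : Lw e o y.
  by apply: LwB; [exact/XLw/(bop_stable hpsi)|exact/LwZ/XLw].
have E0 := normw_ge0 Ly; set E := normw e o y in E0 *.
have xy v : c * cmod (x v) <= cmod (y v).
  by rewrite yE cmodM ler_wpM2r ?cmod_ge0.
rewrite mulrDl.
apply: le_trans (normw_le (B := (1 + (C + C) * 2 / c) / c * E) _) _;
  last first.
  rewrite lerD2r mulrC ler_pdivlMr // mulrC; apply: le_trans (xy o) _.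
  exact: root_le_normw.
move=> v; have [->|vo] := eqVneq v o.
  rewrite wderiv_root mulr_ge0 // divr_ge0 ?(ltW c0) // addr_ge0 //.
  by rewrite divr_ge0 ?(ltW c0) // mulr_ge0 // addr_ge0.
rewrite mulrAC ler_pdivlMr //.
have [lv hlv] : exists n, level e o v = n.+1.
  by rewrite (level_parent hT vo); eexists.
set p := parent e o v.
have h1 : c * derivT e o x v <= derivT e o y v + derivT e o psi v * cmod (x v).
  apply: (@le_trans _ _ (cmod (psi p - l) * derivT e o x v)).
    by rewrite ler_wpM2r ?cmod_ge0.
  rewrite /derivT -/p !yE -!cmodM; apply: le_trans (cmodB _ _).
  by rewrite le_eqVlt; apply/predU1P; left; congr cmod; ring.
have h2 : cmod (x v) <= E * (H (level e o v) * 2) / c.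
  rewrite ler_pdivlMr // mulrC; apply: le_trans (xy v) _.
  apply: le_trans (cmod_le_normw v Ly) _; rewrite -/E ler_wpM2l //.
  (* Away from the root [1 <= H], so [1 + H <= 2 H]; this turns the growth factor into the one that
     [hC] absorbs. *)
  by rewrite mulr_natr mulr2n lerD2r hlv harmonic_sum_ge1.
have h3 := wderiv_le_normw v Ly; rewrite -/E in h3.
rewrite /wderiv mulrC mulrCA.
apply: le_trans (ler_wpM2l _ h1) _; first exact: ler0n.
rewrite mulrDr mulrDl mul1r; apply: lerD => //.
apply: (@le_trans _ _ ((level e o v)%:R *
    (derivT e o psi v * (E * (H (level e o v) * 2) / c)))).
  by rewrite ler_wpM2l // ler_wpM2l // cmod_ge0.
rewrite [leLHS](_ : _ = (level e o v)%:R * H (level e o v) *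
    derivT e o psi v * (2 / c * E)); last by ring.
rewrite [leRHS](_ : _ = (C + C) * (2 / c * E)); last by ring.
  apply: ler_wpM2r (hC v).
by rewrite mulr_ge0 // divr_ge0 // ltW.
Qed.

(** * The approximate point spectrum *)

Lemma approx_point_spectrum_multop :
  approx_point_spectrum X (normw e o) (multop psi) =
  closure (range psi : set (R[i] : numFieldType)).
Proof.
apply/seteqP; split=> l; last first.
  move=> /closure_cmod cl.
  have /choice[v hv] n : exists v, cmod (psi v - l) < harmonic n.
    by have [_ [v _ <-] h] := cl _ (harmonic_gt0 n); exists v.
  pose a n : R := (normw e o (indic_vertex (v n)))^-1.
  pose x n := (a n)%:C%C *: indic_vertex (v n).
  have x1 n : normw e o (x n) = 1.
    rewrite normwZ ?cmod_real; last exact: Lw_indic_vertex.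
    have := normw_indic_vertex_gt0 (v n) => h.
    by rewrite ger0_norm ?mulVf ?gt_eqF // invr_ge0 ltW.
  exists x; split=> //; first by move=> n; apply/Lw0X/Lw0_indic_vertex.
  (* [x n] is a unit eigenvector for [psi (v n)], so the defect is exactly the distance from
     [psi (v n)] to [l]. *)
  have nE n : normw e o (multop psi (x n) - l *: x n) = cmod (psi (v n) - l).
    rewrite -[RHS]mulr1 -(x1 n) -normwZ; last exact/LwZ/Lw_indic_vertex.
    congr normw; rewrite scalerBl; congr (_ - _).
    rewrite /x scalerA mulrC -scalerA -multop_indic_vertex.
    by apply/funext => u; rewrite -[RHS]/(_ * (_ * _)) mulrCA.
  apply: (@squeeze_cvgr _ _ _ _ (cst 0) (@harmonic R)).
  - by apply: nearW => n; rewrite nE cmod_ge0 ltW.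
  - exact: cvg_cst.
  - exact: cvg_harmonic.
move=> [x [Xx x1 /cvgrPdist_lt xl]]; apply: contrapT => ncl.
have [c c0 hc] : exists2 c : R, 0 < c & forall v, c <= cmod (psi v - l).
  apply: contrapT => nc; apply/ncl/closure_cmod => eps eps0.
  apply: contrapT => nz; apply: nc; exists eps => // v.
  by rewrite leNgt; apply/negP => h; apply: nz; exists (psi v) => //; exists v.
have [K K0 hK] := multiplier_bounded_below c0 hc.
(* A defect below [K^-1] at a unit vector contradicts the lower bound [hK]. *)
have /xl[n _ /(_ n (leqnn n)) /=] : 0 < K^-1 by rewrite invr_gt0.
rewrite sub0r normrN => h.
have := hK _ (Xx n); rewrite x1 leNgt => /negP; apply.
rewrite -(ltr_pM2l K0) mulfV ?gt_eqF // in h.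
exact: le_lt_trans (ler_wpM2l (ltW K0) (ler_norm _)) h.
Qed.

End Multiplier.

End Lipschitz.

Theorem corollary6p3 (R : realType) (V : choiceType) (e : rel V) (o : V)
    (hT : is_tree e) (X : set (V -> R[i])) (hX : X = Lw e o \/ X = Lw0 e o)
    (psi : V -> R[i]) (hpsi : bounded_operator X (normw e o) (multop psi)) :
  approx_point_spectrum X (normw e o) (multop psi) =
  closure (range psi : set (R[i] : numFieldType)).
Proof.
apply: (approx_point_spectrum_multop hT _ _ hpsi);
  by case: hX => -> // f [].
Qed.
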